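(* The space $\mathcal{A}(\mathbb{H})$, with the inner product $\langle\cdot,\cdot\rangle_{\mathcal{A}(\mathbb{H})}$ given in the context, is a right quaternionic reproducing kernel Hilbert space whose reproducing kernel is $$G(p,q)=G_q(p)=\sum_{k=0}^\infty T_k(p)\,\overline{T_k(q)},\qquad (p,q)\in\mathbb{H}\times\mathbb{H}.$$ Moreover, for every $q\in\mathbb{H}$ and every $f\in\mathcal{A}(\mathbb{H})$, $$f(q)=\langle f,G_q\rangle_{\mathcal{A}(\mathbb{H})}.$$
   Context: $\mathbb{H}$ denotes the quaternions. For $k\ge0$ and $q\in\mathbb{H}$, $$Q_k(q)=\sum_{j=0}^k\frac{2(k-j+1)}{(k+1)(k+2)}\,q^{k-j}\,\overline q^{\,j},\qquad T_k(q)=\sqrt{\tfrac{(k+1)(k+2)}{k!}}\;Q_k(q).$$ $\mathcal{A}(\mathbb{H})$ is the right $\mathbb{H}$-vector space of all functions $f:\mathbb{H}\to\mathbb{H}$ of the form $f(q)=\sum_{k=0}^\infty Q_k(q)\alpha_k$ with $\alpha_k\in\mathbb{H}$ and $\sum_{k=0}^\infty\frac{k!}{(k+1)(k+2)}|\alpha_k|^2<\infty$ (it equals the image of the slice hyperholomorphic Fock space under the Laplacian $\Delta$ of $\mathbb{R}^4$). For $f=\sum_kQ_k\alpha_k$ and $g=\sum_kQ_k\beta_k$ in $\mathcal{A}(\mathbb{H})$, $$\langle f,g\rangle_{\mathcal{A}(\mathbb{H})}=\sum_{k=0}^\infty\frac{k!}{(k+1)(k+2)}\,\overline{\beta_k}\,\alpha_k.$$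 A right quaternionic reproducing kernel Hilbert space is a complete right quaternionic inner product space of functions on which all point evaluations are continuous. *)

(* Defs.v *)
From HB Require Import structures.
From mathcomp Require Import all_boot all_order all_algebra.
From mathcomp Require Import all_classical all_reals all_analysis.
From mathcomp Require Import ring lra.

Set Implicit Arguments.
Unset Strict Implicit.
Unset Printing Implicit Defensive.

Import Order.TTheory GRing.Theory Num.Theory.
Import numFieldNormedType.Exports.

Local Open Scope classical_set_scope.
Local Open Scope ring_scope.

(* [Quat a b c d] stands for a + b i + c j + d k. A record is used rather than
   a product of copies of [R], since products already carry the componentwise
   ring structure and the sup norm. *)
Record quat (R : realType) := Quat { qre : R; qi : R; qj : R; qk : R }.

Section QuaternionAlgebra.
Variable R : realType.
Implicit Types (x y z : quat R) (a b : R).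

Definition quat_tuple x : R * R * R * R := (qre x, qi x, qj x, qk x).
Definition tuple_quat (t : R * R * R * R) : quat R :=
  Quat t.1.1.1 t.1.1.2 t.1.2 t.2.

Lemma quat_tupleK : cancel quat_tuple tuple_quat.
Proof. by case. Qed.

HB.instance Definition _ := Choice.copy (quat R) (can_type quat_tupleK).

Lemma quatP x y :
  [/\ qre x = qre y, qi x = qi y, qj x = qj y & qk x = qk y] -> x = y.
Proof. by case: x y => [? ? ? ?] [? ? ? ?] /= [-> -> -> ->]. Qed.

Definition quat_add x y :=
  Quat (qre x + qre y) (qi x + qi y) (qj x + qj y) (qk x + qk y).
Definition quat_opp x := Quat (- qre x) (- qi x) (- qj x) (- qk x).
Definition quat_zero : quat R := Quat 0 0 0 0.
Definition quat_one : quat R := Quat 1 0 0 0.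
Definition quat_mul x y := Quat
  (qre x * qre y - qi x * qi y - qj x * qj y - qk x * qk y)
  (qre x * qi y + qi x * qre y + qj x * qk y - qk x * qj y)
  (qre x * qj y - qi x * qk y + qj x * qre y + qk x * qi y)
  (qre x * qk y + qi x * qj y - qj x * qi y + qk x * qre y).
Definition quat_scale a x := Quat (a * qre x) (a * qi x) (a * qj x) (a * qk x).
Definition quat_conj x := Quat (qre x) (- qi x) (- qj x) (- qk x).
Definition quat_norm x : R :=
  Num.sqrt (qre x ^+ 2 + qi x ^+ 2 + qj x ^+ 2 + qk x ^+ 2).

Lemma quat_addA : associative quat_add.
Proof. by move=> x y z; apply: quatP; split; rewrite /= addrA. Qed.
Lemma quat_addC : commutative quat_add.
Proof. by move=> x y; apply: quatP; split; rewrite /= addrC. Qed.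
Lemma quat_add0l : left_id quat_zero quat_add.
Proof. by move=> x; apply: quatP; split; rewrite /= add0r. Qed.
Lemma quat_addNl : left_inverse quat_zero quat_opp quat_add.
Proof. by move=> x; apply: quatP; split; rewrite /= addNr. Qed.

HB.instance Definition _ :=
  GRing.isZmodule.Build (quat R) quat_addA quat_addC quat_add0l quat_addNl.

Lemma quat_mulA : associative quat_mul.
Proof. by move=> x y z; apply: quatP; split => /=; ring. Qed.
Lemma quat_mul1l : left_id quat_one quat_mul.
Proof. by move=> x; apply: quatP; split => /=; ring. Qed.
Lemma quat_mul1r : right_id quat_one quat_mul.
Proof. by move=> x; apply: quatP; split => /=; ring. Qed.
Lemma quat_mulDl : left_distributive quat_mul quat_add.
Proof. by move=> x y z; apply: quatP; split => /=; ring. Qed.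
Lemma quat_mulDr : right_distributive quat_mul quat_add.
Proof. by move=> x y z; apply: quatP; split => /=; ring. Qed.
Lemma quat_one_neq0 : quat_one != quat_zero.
Proof. by apply/eqP => -[] /eqP; rewrite oner_eq0. Qed.

HB.instance Definition _ := GRing.Zmodule_isNzRing.Build (quat R)
  quat_mulA quat_mul1l quat_mul1r quat_mulDl quat_mulDr quat_one_neq0.

Lemma quat_scaleA a b x : quat_scale a (quat_scale b x) = quat_scale (a * b) x.
Proof. by apply: quatP; split => /=; ring. Qed.
Lemma quat_scale1 : left_id 1 quat_scale.
Proof. by move=> x; apply: quatP; split; rewrite /= mul1r. Qed.
Lemma quat_scaleDr : right_distributive quat_scale quat_add.
Proof. by move=> a x y; apply: quatP; split; rewrite /= mulrDr. Qed.
Lemma quat_scaleDl x : {morph quat_scale^~ x : a b / a + b >-> quat_add a b}.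
Proof. by move=> a b; apply: quatP; split; rewrite /= mulrDl. Qed.

HB.instance Definition _ := GRing.Zmodule_isLmodule.Build R (quat R)
  quat_scaleA quat_scale1 quat_scaleDr quat_scaleDl.

Lemma quat_scaleAl a x y : a *: (x * y) = (a *: x) * y.
Proof. by apply: quatP; split => /=; ring. Qed.

HB.instance Definition _ := GRing.Lmodule_isLalgebra.Build R (quat R) quat_scaleAl.

Lemma quat_scaleAr a x y : a *: (x * y) = x * (a *: y).
Proof. by apply: quatP; split => /=; ring. Qed.

HB.instance Definition _ := GRing.Lalgebra_isAlgebra.Build R (quat R) quat_scaleAr.

Lemma quat_normD x y : quat_norm (x + y) <= quat_norm x + quat_norm y.
Proof.
have sq4_ge0 (a b c d : R) : 0 <= a ^+ 2 + b ^+ 2 + c ^+ 2 + d ^+ 2.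
  by rewrite !addr_ge0 ?sqr_ge0.
case: x y => [x0 x1 x2 x3] [y0 y1 y2 y3]; rewrite /quat_norm /=.
set X := x0 ^+ 2 + _ + _ + _; set Y := y0 ^+ 2 + _ + _ + _.
have X0 : 0 <= X by apply: sq4_ge0.
have Y0 : 0 <= Y by apply: sq4_ge0.
have CS : x0 * y0 + x1 * y1 + x2 * y2 + x3 * y3 <= Num.sqrt X * Num.sqrt Y.
  rewrite -sqrtrM //; apply: (le_trans (ler_norm _)).
  rewrite -sqrtr_sqr ler_sqrt ?mulr_ge0 //.
  rewrite -subr_ge0 [leRHS](_ : _ =
    (x0 * y1 - x1 * y0) ^+ 2 + (x0 * y2 - x2 * y0) ^+ 2 +
    (x0 * y3 - x3 * y0) ^+ 2 + (x1 * y2 - x2 * y1) ^+ 2 +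
    (x1 * y3 - x3 * y1) ^+ 2 + (x2 * y3 - x3 * y2) ^+ 2).
    by rewrite !addr_ge0 ?sqr_ge0.
  by rewrite /X /Y; ring.
rewrite -[leRHS]ger0_norm ?addr_ge0 ?sqrtr_ge0 // -sqrtr_sqr.
rewrite ler_sqrt ?sqr_ge0 // [leRHS]sqrrD !sqr_sqrtr //.
apply: (@le_trans _ _
    (X + (x0 * y0 + x1 * y1 + x2 * y2 + x3 * y3) *+ 2 + Y)).
  by rewrite le_eqVlt; apply/orP; left; apply/eqP; rewrite /X /Y; ring.
by rewrite lerD2r lerD2l lerMn2r CS orbT.
Qed.

Lemma quat_normZ a x : quat_norm (a *: x) = `|a| * quat_norm x.
Proof.
rewrite /quat_norm -sqrtr_sqr -sqrtrM ?sqr_ge0 //; congr Num.sqrt => /=; ring.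
Qed.

Lemma quat_norm_eq0 x : quat_norm x = 0 -> x = 0.
Proof.
move=> /eqP; rewrite sqrtr_eq0 => x0; apply: quatP.
have [? ? ? ?] : [/\ 0 <= qre x ^+ 2, 0 <= qi x ^+ 2, 0 <= qj x ^+ 2 &
  0 <= qk x ^+ 2] by split; apply: sqr_ge0.
by split; apply/eqP; rewrite -sqrf_eq0 eq_le; apply/andP; split; lra.
Qed.

HB.instance Definition _ := @Lmodule_isNormed.Build R (quat R)
  quat_norm quat_normD quat_normZ quat_norm_eq0.

End QuaternionAlgebra.

(* Right quaternionic Hilbert spaces of functions. The vector space operations
   are pointwise and the scalar [a] acts on [f] by [fun x => f x * a]. *)
Section RightQuaternionicRKHS.
Variables (R : realType) (X : Type).
Implicit Types (A : set (X -> quat R)).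
Implicit Types (ip : (X -> quat R) -> (X -> quat R) -> quat R).

Record right_subspace A : Prop := RightSubspace {
  right_subspace0 : A (fun=> 0);
  right_subspaceD : forall f g, A f -> A g -> A (fun x => f x + g x);
  right_subspaceZ : forall f (a : quat R), A f -> A (fun x => f x * a) }.

(* Right linear in the first argument, hence conjugate linear in the second. *)
Record right_inner_product A ip : Prop := RightInnerProduct {
  ip_addl : forall f g h, A f -> A g -> A h ->
    ip (fun x => f x + g x) h = ip f h + ip g h;
  ip_scalel : forall f h (a : quat R), A f -> A h ->
    ip (fun x => f x * a) h = ip f h * a;
  ip_conj : forall f g, A f -> A g -> ip g f = quat_conj (ip f g);
  ip_ge0 : forall f, A f -> 0 <= qre (ip f f);
  ip_def : forall f, A f -> ip f f = 0 -> f = (fun=> 0) }.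

(* By [ip_conj], [ip f f] is real, so that it equals its real part. *)
Definition ip_norm ip (f : X -> quat R) : R := Num.sqrt (qre (ip f f)).

Definition ip_dist ip (f g : X -> quat R) : R :=
  ip_norm ip (fun x => f x - g x).

Definition ip_complete A ip : Prop :=
  forall u : nat -> X -> quat R, (forall n, A (u n)) ->
    (forall e : R, 0 < e -> exists N : nat, forall m n : nat,
      (N <= m)%N -> (N <= n)%N -> ip_dist ip (u m) (u n) < e) ->
    exists2 f, A f & (fun n => ip_dist ip (u n) f) @ \oo --> (0 : R).

Definition evaluation_continuous A ip (x : X) : Prop :=
  forall f, A f -> forall e : R, 0 < e ->
    exists2 d : R, 0 < d &
      forall g, A g -> ip_dist ip g f < d -> `|g x - f x| < e.

Record right_rkhs A ip : Prop := RightRKHS {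
  rkhs_subspace : right_subspace A;
  rkhs_inner_product : right_inner_product A ip;
  rkhs_complete : ip_complete A ip;
  rkhs_evaluation : forall x, evaluation_continuous A ip x }.

Definition reproducing_kernel A ip (K : X -> X -> quat R) : Prop :=
  forall x, A (K^~ x) /\ forall f, A f -> f x = ip f (K^~ x).

End RightQuaternionicRKHS.

Section SpaceA.
Variable R : realType.
Local Notation H := (quat R).

Definition Qpoly (k : nat) (q : H) : H :=
  \sum_(0 <= j < k.+1)
    ((2 * (k - j + 1))%:R / ((k + 1) * (k + 2))%:R : R) *:
      (q ^+ (k - j) * quat_conj q ^+ j).

Definition Tpoly (k : nat) (q : H) : H :=
  Num.sqrt (((k + 1) * (k + 2))%:R / k`!%:R : R) *: Qpoly k q.

Definition A_weight (k : nat) : R := k`!%:R / ((k + 1) * (k + 2))%:R.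

Definition A_coefs (f : H -> H) (alpha : nat -> H) : Prop :=
  cvgn (series (fun k => A_weight k * `|alpha k| ^+ 2)) /\
  forall q, series (fun k => Qpoly k q * alpha k) @ \oo --> f q.

Definition A_space : set (H -> H) := [set f | exists alpha, A_coefs f alpha].

Definition A_ip_term (alpha beta : nat -> H) (k : nat) : H :=
  A_weight k *: (quat_conj (beta k) * alpha k).

(* Some sequence of coefficients of [f], the zero sequence if there is none. *)
Definition A_coef (f : H -> H) : nat -> H := xget (fun=> 0) (A_coefs f).

Definition A_ip (f g : H -> H) : H :=
  limn (series (A_ip_term (A_coef f) (A_coef g))).

Definition A_kernel_term (p q : H) (k : nat) : H :=
  Tpoly k p * quat_conj (Tpoly k q).

Definition A_kernel (p q : H) : H := limn (series (A_kernel_term p q)).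

End SpaceA.

(* Main.v *)
From HB Require Import structures.
Require Import Defs.
From mathcomp Require Import all_boot all_order all_algebra.
From mathcomp Require Import all_classical all_reals all_analysis.
From mathcomp Require Import ring lra zify.

(** Write w_k = k!/((k+1)(k+2)) for the weight of the k-th coefficient.
    Everything reduces to the weighted sequence space of the alpha with
    sum_k w_k |alpha_k|^2 finite, in which the space of functions is embedded by
    f = sum_k Q_k alpha_k |-> alpha.

    This correspondence is a bijection. The coefficients of Q_k add up to 1, so
    Q_k(t) = t^k at a real point t ([Qpoly_real]): the restriction of f to the
    real axis is a power series, which determines alpha ([power_series_eq0],
    [A_coefs_uniq]). The inner product is therefore the weighted one of the
    coefficients, for whichever coefficients are used ([A_ip_cvg]). Conversely
    |Q_k(q)| <= |q|^k ([Qpoly_norm]), so the sequence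
    beta_k = w_k^-1 conj(Q_k(q)) is in the weighted space, the series
    sum_k w_k^-1 |Q_k(q)|^2 being dominated by an exponential one
    ([ell2_kernel_coef]). By Young's inequality the series of an arbitrary alpha
    of the weighted space then converges at q ([A_fun_coefs]).

    Since w_k conj(beta_k) alpha_k = Q_k(q) alpha_k, the value f(q) is the inner
    product of alpha with beta, and since T_k = w_k^(-1/2) Q_k, the function with
    coefficients beta is the kernel at q ([A_kernel_coefs],
    [A_kernel_reproducing]). The same estimate bounds the evaluation at q
    ([A_eval_bounded]). Completeness is that of a weighted l^2 space
    ([A_complete]): coefficients converge one by one, the quaternions
    being complete, and bounds on partial sums pass to the limit. *)
Set Implicit Arguments.
Unset Strict Implicit.
Unset Printing Implicit Defensive.
Import Order.TTheory GRing.Theory Num.Theory.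
Import numFieldNormedType.Exports.
Local Open Scope classical_set_scope.
Local Open Scope ring_scope.

(** * The quaternions as a complete normed algebra *)

Section QuaternionNorm.
Variable R : realType.
Implicit Types x y z : quat R.

Lemma quat_conjD : {morph @quat_conj R : x y / x + y}.
Proof. by move=> x y; apply: quatP; split=> //=; rewrite opprD. Qed.

Lemma quat_conjZ (a : R) x : quat_conj (a *: x) = a *: quat_conj x.
Proof. by apply: quatP; split=> //=; rewrite mulrN. Qed.

Lemma quat_conjM x y : quat_conj (x * y) = quat_conj y * quat_conj x.
Proof. by apply: quatP; split=> /=; ring. Qed.

Lemma quat_conjK : involutive (@quat_conj R).
Proof. by move=> x; apply: quatP; split=> //=; rewrite opprK. Qed.

Lemma quat_norm_sqr x :
  `|x| ^+ 2 = qre x ^+ 2 + qi x ^+ 2 + qj x ^+ 2 + qk x ^+ 2.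
Proof. by rewrite sqr_sqrtr// !addr_ge0 ?sqr_ge0. Qed.

Lemma quat_norm_conj x : `|quat_conj x| = `|x|.
Proof. by congr (Num.sqrt _) => /=; rewrite !sqrrN. Qed.

Lemma quat_normM x y : `|x * y| = `|x| * `|y|.
Proof.
apply/eqP; rewrite -(@eqrXn2 _ 2%N)// ?mulr_ge0//.
by rewrite exprMn !quat_norm_sqr /=; apply/eqP; ring.
Qed.

Lemma quat_norm1 : `|1 : quat R| = 1.
Proof.
by apply/eqP; rewrite -(@eqrXn2 _ 2%N)// quat_norm_sqr /= expr0n/= !addr0.
Qed.

Lemma quat_normX x n : `|x ^+ n| = `|x| ^+ n.
Proof.
elim: n => [|n IH]; first by rewrite !expr0 quat_norm1.
by rewrite !exprS quat_normM IH.
Qed.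

Lemma quat_conj_mul x : quat_conj x * x = `|x| ^+ 2 *: 1.
Proof. by rewrite quat_norm_sqr; apply: quatP; split => /=; ring. Qed.

Lemma le_norm_coord x :
  [/\ `|qre x| <= `|x|, `|qi x| <= `|x|, `|qj x| <= `|x| & `|qk x| <= `|x|].
Proof.
have [? ? ? ?] : [/\ 0 <= qre x ^+ 2, 0 <= qi x ^+ 2, 0 <= qj x ^+ 2 &
  0 <= qk x ^+ 2] by split; apply: sqr_ge0.
split; rewrite -(@ler_pXn2r _ 2%N) ?nnegrE// quat_norm_sqr.
all: by rewrite real_normK ?num_real//; lra.
Qed.

Lemma le_norm_sum x : `|x| <= `|qre x| + `|qi x| + `|qj x| + `|qk x|.
Proof.
rewrite -(@ler_pXn2r _ 2%N)// ?nnegrE ?addr_ge0// quat_norm_sqr.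
rewrite -!(@real_normK _ (_ x)) ?num_real//.
move: (normr_ge0 (qre x)) (normr_ge0 (qi x)).
move: (normr_ge0 (qj x)) (normr_ge0 (qk x)).
move: `|_| `|_| `|_| `|_| => a b c d c0 d0 a0 b0.
have ? : 0 <= a * b by rewrite mulr_ge0.
have ? : 0 <= a * c by rewrite mulr_ge0.
have ? : 0 <= a * d by rewrite mulr_ge0.
have ? : 0 <= b * c by rewrite mulr_ge0.
have ? : 0 <= b * d by rewrite mulr_ge0.
have ? : 0 <= c * d by rewrite mulr_ge0.
lra.
Qed.

(** The four coordinates are 1-Lipschitz and control the norm, so that Cauchy
    filters converge coordinatewise. *)
Lemma quat_complete (F : set_system (quat R)) :
  ProperFilter F -> cauchy F -> cvg F.
Proof.
move=> PF /cauchyP cF.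
have coord (c : quat R -> R) : (forall x y, `|c x - c y| <= `|x - y|) ->
    cvg (c @ F).
  move=> cL; apply: cauchy_cvg; apply: cauchy_exP => e /cF[z Fz].
  exists (c z); apply: (@filterS _ F _ (ball z e)) Fz => x.
  by rewrite -!ball_normE /=; apply: le_lt_trans; exact: cL.
have Cre : cvg (@qre R @ F).
  by apply: coord => x y; have [] := le_norm_coord (x - y).
have Ci : cvg (@qi R @ F).
  by apply: coord => x y; have [] := le_norm_coord (x - y).
have Cj : cvg (@qj R @ F).
  by apply: coord => x y; have [] := le_norm_coord (x - y).
have Ck : cvg (@qk R @ F).
  by apply: coord => x y; have [] := le_norm_coord (x - y).
apply/cvg_ex; exists (Quat (lim (@qre R @ F)) (lim (@qi R @ F))
  (lim (@qj R @ F)) (lim (@qk R @ F))).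
apply/(@cvgrPdist_lt _ _ _ F _ id) => e e0; have e4 : 0 < e / 4 by lra.
near=> x; apply: (le_lt_trans (le_norm_sum _)) => /=.
rewrite [ltRHS](_ : _ = e / 4 + e / 4 + e / 4 + e / 4); last by lra.
by rewrite !ltrD//; near: x; apply: cvgr_dist_lt.
Unshelve. all: by end_near. Qed.

HB.instance Definition _ :=
  Uniform_isComplete.Build (quat R) quat_complete.

End QuaternionNorm.

(** * Series in normed spaces *)

Section SeriesLemmas.
Context {R : realType}.

(** Serves to pass to the limit through conjugation, multiplication by a fixed
    quaternion and the real part. *)
Lemma additive_bounded_cvg (V W : normedModType R) (g : V -> W) (C : R)
    (u : V^nat) (l : V) :
  {morph g : x y / x + y} -> (forall x, `|g x| <= C * `|x|) ->
  u @ \oo --> l -> g \o u @ \oo --> g l.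
Proof.
move=> gD gC ul.
have gB x y : g x - g y = g (x - y).
  by apply/eqP; rewrite subr_eq -gD subrK.
have CD : C < `|C| + 1 by rewrite (le_lt_trans (ler_norm _))// ltrDl.
apply/cvgrPdist_lt => e e0; near=> n => /=.
rewrite gB (le_lt_trans (gC _))//.
apply: (@le_lt_trans _ _ ((`|C| + 1) * `|l - u n|)).
  by rewrite ler_wpM2r// ltW.
rewrite -ltr_pdivlMl ?ltr_wpDl// mulrC.
near: n; apply: cvgr_dist_lt => //; rewrite divr_gt0// ltr_wpDl//.
Unshelve. all: by end_near. Qed.

Lemma additive_bounded_series (V W : normedModType R) (g : V -> W) (C : R)
    (u : V^nat) (l : V) :
  {morph g : x y / x + y} -> (forall x, `|g x| <= C * `|x|) ->
  series u @ \oo --> l -> series (g \o u) @ \oo --> g l.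
Proof.
move=> gD gC ul.
have g0 : g 0 = 0 by apply: (addrI (g 0)); rewrite -gD !addr0.
have -> : series (g \o u) = g \o series u.
  by apply/funext => n /=; rewrite /series /= (big_morph g gD g0).
exact: additive_bounded_cvg gD gC ul.
Qed.

Lemma cvg_series_add (V : normedModType R) (u v : V^nat) (l m : V) :
  series u @ \oo --> l -> series v @ \oo --> m ->
  series (fun k => u k + v k) @ \oo --> l + m.
Proof.
move=> ul vm; have -> : series (fun k => u k + v k) =
    fun n => series u n + series v n.
  by apply/funext => n; rewrite /series /= big_split.
exact: cvgD.
Qed.

Lemma cvg_series_comb (u v : R^nat) (a b l m : R) :
  series u @ \oo --> l -> series v @ \oo --> m ->
  series (fun k => a * u k + b * v k) @ \oo --> a * l + b * m.
Proof.
move=> ul vm; have cZ (c n : R) (w : R^nat) : series w @ \oo --> n ->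
    series (fun k => c * w k) @ \oo --> c * n.
  move=> wn; apply: (@additive_bounded_series R^o R^o (fun x => c * x) `|c|) wn.
    by move=> x y; rewrite mulrDr.
  by move=> x; rewrite normrM.
by apply: cvg_series_add; exact: cZ.
Qed.

Lemma dominated_series (V : completeNormedModType R) (u : V^nat) (v : R^nat) :
  (forall n, `|u n| <= v n) -> cvgn (series v) -> cvgn (series u).
Proof.
move=> uv cv; apply: normed_cvg.
apply: (series_le_cvg _ _ uv cv) => n //.
exact: le_trans (normr_ge0 _) (uv n).
Qed.

Lemma cvgn_le_bound (u : R^nat) (l c : R) :
  u @ \oo --> l -> (\forall n \near \oo, u n <= c) -> l <= c.
Proof.
move=> ul uc; rewrite -(cvg_lim _ ul)//.
by apply: limr_le => //; exact: cvgP ul.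
Qed.

Lemma dominated_series_comb (V : completeNormedModType R) (w : V^nat)
    (u v : R^nat) (a b : R) :
  cvgn (series u) -> cvgn (series v) ->
  (forall n, `|w n| <= a * u n + b * v n) -> cvgn (series w).
Proof.
move=> cu cv bd; apply: (dominated_series bd); apply: cvgP.
exact: cvg_series_comb cu cv.
Qed.

Lemma series_le_limn (u : R^nat) (l : R) : (forall n, 0 <= u n) ->
  series u @ \oo --> l -> forall n, series u n <= l.
Proof.
move=> u0 ul n; rewrite -(cvg_lim _ ul)//.
apply: nondecreasing_cvgn_le; last by apply/cvg_ex; exists l.
exact: nondecreasing_series.
Qed.

Lemma bounded_series (u : R^nat) (C : R) : (forall n, 0 <= u n) ->
  (forall n, series u n <= C) -> cvgn (series u).
Proof.
move=> u0 uC; apply: nondecreasing_is_cvgn.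
  exact: nondecreasing_series.
by exists C => _ [n _ <-].
Qed.

Lemma norm_series_le (V : normedModType R) (u : V^nat) (v : R^nat)
    (l : V) (m : R) :
  (forall n, `|u n| <= v n) -> series u @ \oo --> l -> series v @ \oo --> m ->
  `|l| <= m.
Proof.
move=> uv ul vm.
have nl : (`|series u n| @[n --> \oo]) --> `|l| by exact: cvg_norm.
rewrite -(cvg_lim _ nl)// -(cvg_lim _ vm)//; apply: ler_lim.
- by apply/cvg_ex; exists `|l|.
- by apply/cvg_ex; exists m.
- by apply: nearW => n; rewrite (le_trans (ler_norm_sum _ _ _))// ler_sum.
Qed.

Lemma young_ineq (c a b : R) : 0 < c -> 0 <= a -> 0 <= b ->
  a * b <= c * a ^+ 2 + c^-1 * b ^+ 2.
Proof.
move=> c0 a0 b0; rewrite -subr_ge0.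
have -> : c * a ^+ 2 + c^-1 * b ^+ 2 - a * b =
    c^-1 * ((c * a - b) ^+ 2 + c * (a * b)).
  by field; rewrite gt_eqF.
by rewrite mulr_ge0 ?invr_ge0 ?(ltW c0)// addr_ge0 ?sqr_ge0// !mulr_ge0// ltW.
Qed.

(** If a_0, .., a_(n-1) vanish, dividing the series by t^n and isolating a_n
    leaves -a_n = sum_k t^(k+1) a_(n+k+1). With M a bound for the coefficients
    this gives |a_n| <= M t / (1 - t), which is absurd for a small t unless
    a_n = 0. *)
Lemma power_series_eq0 (V : normedModType R) (a : V^nat) :
  (forall t : R, 0 < t -> series (fun k => t ^+ k *: a k) @ \oo --> (0 : V)) ->
  forall k, a k = 0.
Proof.
move=> a0.
have [M M0 aM] : exists2 M : R, 0 <= M & forall k, `|a k| <= M.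
  (* At t = 1 the terms of the convergent series are the coefficients. *)
  have := a0 1 ltr01; under eq_fun do rewrite expr1n scale1r.
  move=> /cvgP/cvg_series_cvg_0/cvgP/cvg_seq_bounded.
  move=> [M [_ Mb]]; have aM k : `|a k| <= `|M| + 1.
    by apply: Mb => //; rewrite (le_lt_trans (ler_norm _))// ltrDl.
  by exists (`|M| + 1) => //; rewrite (le_trans _ (aM 0%N)).
elim/ltn_ind => n IH; apply/eqP; rewrite -normr_eq0; apply/negPn/negP => x0.
have {}x0 : 0 < `|a n| by rewrite lt_neqAle eq_sym x0 normr_ge0.
(* Chosen so that |a n| * (1 - t) <= M * t reads |a n| <= |a n| / 2. *)
pose t := `|a n| / (2 * (`|a n| + M)).
have d0 : 0 < `|a n| + M by rewrite ltr_pwDl.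
have t0 : 0 < t by rewrite divr_gt0// mulr_gt0.
have tn : t * (`|a n| + M) = `|a n| / 2.
  by rewrite /t; field; rewrite gt_eqF.
have t1 : t < 1.
  by rewrite -(@ltr_pM2r _ (`|a n| + M))// tn mul1r; lra.
have tail : series (fun k => t ^+ k.+1 *: a (n + k.+1)%N) @ \oo --> - a n.
  have -> : series (fun k => t ^+ k.+1 *: a (n + k.+1)%N) =
      fun N => t ^- n *: series (fun k => t ^+ k *: a k) (N + n.+1)%N - a n.
    apply/funext => N; rewrite /series /=.
    rewrite (@big_cat_nat _ _ _ n 0 (N + n.+1))//=; last first.
      by rewrite addnS leqW// leq_addl.
    have -> : \sum_(0 <= k < n) t ^+ k *: a k = 0.
      rewrite big_nat_cond big1// => k /andP[/andP[_ kn] _].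
      by rewrite IH// scaler0.
    rewrite add0r.
    rewrite [X in _ *: X - _]big_ltn; last by rewrite addnS ltnS leq_addl.
    rewrite scalerDr scalerA mulVf ?expf_neq0 ?gt_eqF// scale1r addrC addKr.
    rewrite -{1}[n.+1]add0n big_addn addnK scaler_sumr; apply: eq_bigr => i _.
    rewrite scalerA; have -> : (i + n.+1 = n + i.+1)%N by rewrite addnC addSnnS.
    by rewrite exprD mulrA mulVf ?mul1r// expf_neq0// gt_eqF.
  rewrite -[X in _ --> X]add0r; apply: cvgB; last exact: cvg_cst.
  rewrite -[X in _ --> X](scaler0 _ (t ^- n)); apply: cvgZr.
  by rewrite (cvg_shiftn n.+1 (series _)); exact: a0.
have geo : series (geometric (M * t) t) @ \oo --> M * t / (1 - t).
  by apply: cvg_geometric_series; rewrite gtr0_norm.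
have dom k : `|t ^+ k.+1 *: a (n + k.+1)%N| <= geometric (M * t) t k.
  rewrite normrZ ger0_norm ?exprn_ge0 ?(ltW t0)// [leLHS]mulrC.
  rewrite [leRHS](_ : _ = M * t ^+ k.+1); last first.
    by rewrite /geometric /= -mulrA -exprS.
  by rewrite ler_wpM2r// exprn_ge0// ltW.
have := norm_series_le dom tail geo.
rewrite normrN ler_pdivlMr ?subr_gt0//.
move: tn x0; lra.
Qed.

End SeriesLemmas.

(** * The polynomials Q_k and the weighted sequence space *)

Section WeightedSequences.
Context {R : realType}.
Local Notation H := (quat R).
Implicit Types (p q : H) (k : nat).

Lemma A_weight_gt0 k : 0 < A_weight R k.
Proof. by rewrite divr_gt0// ltr0n ?fact_gt0// !addn1 addn2. Qed.

Lemma Qpoly_coef_sum k :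
  \sum_(0 <= j < k.+1) ((2 * (k - j + 1))%:R / ((k + 1) * (k + 2))%:R : R) = 1.
Proof.
have num : (\sum_(0 <= j < k.+1) 2 * (k - j + 1) = (k + 1) * (k + 2))%N.
  rewrite big_nat_rev /= add0n.
  under eq_big_nat => j /andP[_ jk] do rewrite subSS subKn//.
  elim: k => [|k IH]; first by rewrite big_nat1.
  by rewrite big_nat_recr//= IH; ring.
by rewrite -mulr_suml -natr_sum num divff// pnatr_eq0 addn1 addn2.
Qed.

(** On the real axis every monomial of Q_k equals t^k and the weights average
    to 1. *)
Lemma Qpoly_real k (t : R) : Qpoly k (t *: 1) = t ^+ k *: 1.
Proof.
have tconj : quat_conj (t *: 1 : H) = t *: 1.
  by apply: quatP; split=> //=; rewrite mulr0 oppr0.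
rewrite -[RHS]scale1r -[X in _ = X *: _](Qpoly_coef_sum k) scaler_suml.
rewrite /Qpoly tconj.
apply: eq_big_nat => j /andP[_]; rewrite ltnS => jk.
by rewrite -exprD subnK// exprZn expr1n.
Qed.

Lemma Qpoly_norm k q : `|Qpoly k q| <= `|q| ^+ k.
Proof.
apply: (le_trans (ler_norm_sum _ _ _)).
rewrite -[leRHS]mul1r -[X in _ <= X * _](Qpoly_coef_sum k) mulr_suml !big_nat.
apply: ler_sum => j /andP[_]; rewrite ltnS => jk.
rewrite normrZ ger0_norm ?divr_ge0// ler_wpM2l ?divr_ge0//.
by rewrite quat_normM !quat_normX quat_norm_conj -exprD subnK.
Qed.

(** The condition that [A_coefs] puts on the coefficients of a function. *)
Definition ell2 (alpha : nat -> H) :=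
  cvgn (series (fun k => A_weight R k * `|alpha k| ^+ 2)).

Lemma ell2_term_ge0 k (x : H) : 0 <= A_weight R k * `|x| ^+ 2.
Proof. by rewrite mulr_ge0 ?exprn_ge0// ltW ?A_weight_gt0. Qed.

Lemma ell2Z (alpha : nat -> H) (a : H) :
  ell2 alpha -> ell2 (fun k => alpha k * a).
Proof.
move=> sa; apply: (dominated_series_comb (a := `|a| ^+ 2) (b := 0) sa sa) => k.
rewrite /= mul0r addr0 ger0_norm ?ell2_term_ge0//.
by rewrite quat_normM exprMn [leRHS]mulrC mulrA.
Qed.

(** Uses |a + b|^2 <= 2 |a|^2 + 2 |b|^2. *)
Lemma ell2D (alpha beta : nat -> H) :
  ell2 alpha -> ell2 beta -> ell2 (fun k => alpha k + beta k).
Proof.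
move=> sa sb; apply: (dominated_series_comb (a := 2) (b := 2) sa sb) => k.
rewrite ger0_norm ?ell2_term_ge0//= -mulrDr -mulrDr [leRHS]mulrCA.
rewrite ler_wpM2l ?(ltW (A_weight_gt0 _))//.
apply: (@le_trans _ _ ((`|alpha k| + `|beta k|) ^+ 2)).
  by rewrite lerXn2r ?nnegrE ?addr_ge0 ?ler_normD.
have := sqr_ge0 (`|alpha k| - `|beta k|); lra.
Qed.

(** The coefficients of the reproducing kernel at [q]; they are forced by the
    requirement that w_k conj(beta_k) alpha_k = Q_k(q) alpha_k. *)
Definition kernel_coef q k : H := (A_weight R k)^-1 *: quat_conj (Qpoly k q).

Lemma kernel_coef_weight q k :
  A_weight R k * `|kernel_coef q k| ^+ 2 =
    (A_weight R k)^-1 * `|Qpoly k q| ^+ 2.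
Proof.
have w0 := A_weight_gt0 k.
rewrite normrZ quat_norm_conj normrV ?unitfE ?gt_eqF// gtr0_norm//.
by rewrite exprMn; field; rewrite gt_eqF.
Qed.

(** As (k+1)(k+2) <= 2 * 4^k and |Q_k(q)| <= |q|^k, the series is dominated by
    twice the exponential series at 4 |q|^2. *)
Lemma ell2_kernel_coef q : ell2 (kernel_coef q).
Proof.
have ce : cvgn (series (exp_coeff (4 * `|q| ^+ 2))).
  exact: is_cvg_series_exp_coeff.
apply: (dominated_series_comb (a := 2) (b := 0) ce ce) => k.
rewrite ger0_norm ?ell2_term_ge0// kernel_coef_weight mul0r addr0 /exp_coeff/=.
rewrite /A_weight invf_div mulrA mulrAC ler_wpM2r ?invr_ge0//.
have k4 : ((k + 1) * (k + 2) <= 2 * 4 ^ k)%N.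
  elim: k => // k IH; rewrite expnS [X in (_ <= X)%N]mulnCA.
  apply: (@leq_trans (4 * ((k + 1) * (k + 2)))); last first.
    by rewrite leq_mul2l IH orbT.
  nia.
rewrite exprMn [leRHS]mulrA ler_pM ?exprn_ge0//.
  by rewrite -(ler_nat R) in k4; apply: (le_trans k4); rewrite natrM natrX.
by rewrite -exprM mulnC exprM lerXn2r ?nnegrE ?exprn_ge0 ?Qpoly_norm.
Qed.

(** With s = 1 this makes the series of [alpha] converge at [q]; optimizing over
    s turns it into a Cauchy-Schwarz bound. *)
Lemma Qpoly_young (s : R) (alpha : nat -> H) q k : 0 < s ->
  `|Qpoly k q * alpha k| <= s * (A_weight R k * `|alpha k| ^+ 2) +
    s^-1 * (A_weight R k * `|kernel_coef q k| ^+ 2).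
Proof.
move=> s0; rewrite quat_normM kernel_coef_weight [leLHS]mulrC.
rewrite [s * _]mulrA [s^-1 * _]mulrA -invfM.
by apply: young_ineq; rewrite // mulr_gt0 ?A_weight_gt0.
Qed.

Definition A_fun (alpha : nat -> H) q : H :=
  limn (series (fun k => Qpoly k q * alpha k)).

Lemma A_fun_coefs (alpha : nat -> H) :
  ell2 alpha -> A_coefs (A_fun alpha) alpha.
Proof.
move=> sa; split=> // q.
suff : cvgn (series (fun k => Qpoly k q * alpha k)) by [].
apply: (@dominated_series_comb R H _ _ _ 1 1^-1 sa (@ell2_kernel_coef q)) => k.
exact: Qpoly_young.
Qed.

Lemma A_coefsD f g (alpha beta : nat -> H) :
  A_coefs f alpha -> A_coefs g beta ->
  A_coefs (fun q => f q + g q) (fun k => alpha k + beta k).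
Proof.
move=> [sa fa] [sb gb]; split=> [|q]; first exact: ell2D.
by under eq_fun do rewrite mulrDr; exact: cvg_series_add.
Qed.

Lemma A_coefsZ f (alpha : nat -> H) (a : H) :
  A_coefs f alpha -> A_coefs (fun q => f q * a) (fun k => alpha k * a).
Proof.
move=> [sa fa]; split=> [|q]; first exact: ell2Z.
under eq_fun do rewrite mulrA.
apply: (@additive_bounded_series _ _ _ (fun x : H => x * a) `|a|) (fa q).
  by move=> x y; rewrite mulrDl.
by move=> x; rewrite quat_normM mulrC.
Qed.

Lemma A_coefsB f g (alpha beta : nat -> H) :
  A_coefs f alpha -> A_coefs g beta ->
  A_coefs (fun q => f q - g q) (fun k => alpha k - beta k).
Proof.
move=> fa /(A_coefsZ (-1))/(A_coefsD fa).
under eq_fun do rewrite mulrN1.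
by under [X in A_coefs _ X]eq_fun do rewrite mulrN1.
Qed.

(** Restricted to the real axis, the difference of the two expansions of [f] is
    a power series with sum 0. *)
Lemma A_coefs_uniq f (alpha beta : nat -> H) :
  A_coefs f alpha -> A_coefs f beta -> alpha = beta.
Proof.
move=> fa fb; have [_ fab] := A_coefsB fa fb.
apply/funext => k; apply/eqP; rewrite -subr_eq0; apply/eqP.
move: k; apply: (@power_series_eq0 R _ (fun k => alpha k - beta k)) => t _.
rewrite (_ : (fun k => _) = fun k => Qpoly k (t *: 1) * (alpha k - beta k)).
  by have := fab (t *: 1); rewrite subrr.
by apply/funext => k; rewrite Qpoly_real -scalerAl mul1r.
Qed.

Lemma A_coefE f (alpha : nat -> H) : A_coefs f alpha -> A_coef f = alpha.
Proof.
move=> fa; apply: (A_coefs_uniq _ fa); rewrite /A_coef.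
by apply: xgetPex; exists alpha.
Qed.

Lemma A_coefs0 : A_coefs (fun=> 0 : H) (fun=> 0).
Proof.
have -> : (fun=> 0 : H) = A_fun (fun=> 0).
  apply/funext => q; rewrite /A_fun (_ : series _ = cst 0) ?lim_cst//.
  by apply/funext => n; rewrite /series /= big1// => k; rewrite mulr0.
apply: A_fun_coefs; rewrite /ell2 (_ : series _ = cst 0).
  exact: is_cvg_cst.
apply/funext => n; rewrite /series /= big1// => k.
by rewrite normr0 expr0n mulr0.
Qed.

(** * The inner product *)

Lemma A_ip_cvg f g (alpha beta : nat -> H) :
  A_coefs f alpha -> A_coefs g beta ->
  series (A_ip_term alpha beta) @ \oo --> A_ip f g.
Proof.
move=> fa gb; rewrite /A_ip (A_coefE fa) (A_coefE gb).
suff : cvgn (series (A_ip_term alpha beta)) by [].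
apply: (dominated_series_comb (a := 1) (b := 1^-1) gb.1 fa.1) => k.
have w0 := A_weight_gt0 k.
rewrite normrZ (gtr0_norm w0) quat_normM quat_norm_conj /=.
rewrite [1 * _]mulrCA [1^-1 * _]mulrCA.
by rewrite -mulrDr ler_wpM2l ?(ltW w0)// young_ineq.
Qed.

(** By the identity conj(a) a = |a|^2, the norm of the function space is the
    weighted norm of the coefficients. *)
Lemma A_ip_self f (alpha : nat -> H) : A_coefs f alpha ->
  series (fun k => A_weight R k * `|alpha k| ^+ 2) @ \oo --> qre (A_ip f f).
Proof.
move=> fa.
rewrite (_ : (fun k => _) = @qre R \o A_ip_term alpha alpha).
  apply: (@additive_bounded_series _ _ _ _ 1) (A_ip_cvg fa fa) => // x.
  by rewrite mul1r; have [] := le_norm_coord x.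
apply/funext => k; rewrite [RHS](_ : _ =
  qre (A_weight R k *: (quat_conj (alpha k) * alpha k)))//.
by rewrite quat_conj_mul /= mulr1.
Qed.

Lemma A_ip_self_ge0 (f : H -> H) : A_space f -> 0 <= qre (A_ip f f).
Proof.
move=> [alpha fa].
have := series_le_limn (fun k => ell2_term_ge0 k (alpha k)) (A_ip_self fa) 0%N.
by rewrite /series /= big_geq.
Qed.

Lemma A_ip_norm_sqr (f : H -> H) : A_space f ->
  ip_norm (@A_ip R) f ^+ 2 = qre (A_ip f f).
Proof. by move=> Af; rewrite sqr_sqrtr// A_ip_self_ge0. Qed.

Lemma A_ip_norm_coef f (alpha : nat -> H) : A_coefs f alpha ->
  forall n, series (fun k => A_weight R k * `|alpha k| ^+ 2) n <=
    ip_norm (@A_ip R) f ^+ 2.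
Proof.
move=> fa; rewrite A_ip_norm_sqr; last by exists alpha.
exact: (series_le_limn (fun k => ell2_term_ge0 k (alpha k)) (A_ip_self fa)).
Qed.

Lemma A_ip_norm_term f (alpha : nat -> H) : A_coefs f alpha ->
  forall k, A_weight R k * `|alpha k| ^+ 2 <= ip_norm (@A_ip R) f ^+ 2.
Proof.
move=> fa k; apply: le_trans (A_ip_norm_coef fa k.+1).
rewrite /series /= big_nat_recr//= lerDr sumr_ge0// => i _.
exact: ell2_term_ge0.
Qed.

Lemma A_ip_norm_eq0 (f : H -> H) :
  A_space f -> ip_norm (@A_ip R) f = 0 -> f = (fun=> 0).
Proof.
move=> [alpha fa] f0.
have a0 : alpha = (fun=> 0).
  apply/funext => k; apply/eqP; rewrite -normr_eq0 -sqrf_eq0.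
  rewrite -(@mulrI_eq0 _ (A_weight R k)); last first.
    by apply/lregP; rewrite gt_eqF// A_weight_gt0.
  rewrite eq_le ell2_term_ge0 andbT.
  by have := A_ip_norm_term fa k; rewrite f0 expr0n.
apply/funext => q; rewrite a0 in fa.
exact: cvg_unique (fa.2 q) (A_coefs0.2 q).
Qed.

Lemma A_right_subspace : right_subspace (@A_space R).
Proof.
split.
- by exists (fun=> 0); exact: A_coefs0.
- by move=> f g [a fa] [b gb]; exists (fun k => a k + b k); exact: A_coefsD.
- by move=> f c [a fa]; exists (fun k => a k * c); exact: A_coefsZ.
Qed.

Lemma A_right_inner_product : right_inner_product (@A_space R) (@A_ip R).
Proof.
split.
- move=> f g h [a fa] [b gb] [c hc].
  have fgh := A_ip_cvg (A_coefsD fa gb) hc.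
  apply: cvg_unique fgh _ => //.
  rewrite (_ : A_ip_term _ _ = fun k => A_ip_term a c k + A_ip_term b c k).
    by apply: cvg_series_add; exact: A_ip_cvg.
  by apply/funext => k; rewrite /A_ip_term mulrDr scalerDr.
- move=> f h x [a fa] [c hc].
  have fh := A_ip_cvg (A_coefsZ x fa) hc.
  apply: cvg_unique fh _ => //.
  rewrite (_ : A_ip_term _ _ = (fun y => y * x) \o A_ip_term a c).
    apply: (@additive_bounded_series _ _ _ _ `|x|) (A_ip_cvg fa hc).
      by move=> y z; rewrite mulrDl.
    by move=> y; rewrite quat_normM mulrC.
  by apply/funext => k; rewrite /A_ip_term /= mulrA scalerAl.
- move=> f g [a fa] [b gb].
  have gf := A_ip_cvg gb fa.
  apply: cvg_unique gf _ => //.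
  rewrite (_ : A_ip_term _ _ = @quat_conj R \o A_ip_term a b).
    apply: (@additive_bounded_series _ _ _ _ 1) (A_ip_cvg fa gb).
      exact: quat_conjD.
    by move=> y; rewrite mul1r quat_norm_conj.
  by apply/funext => k; rewrite /A_ip_term /= quat_conjZ quat_conjM quat_conjK.
- exact: A_ip_self_ge0.
- by move=> f Af f0; apply: A_ip_norm_eq0; rewrite // /ip_norm f0 sqrtr0.
Qed.

Lemma A_spaceB (f g : H -> H) :
  A_space f -> A_space g -> @A_space R (fun q => f q - g q).
Proof.
by move=> [a fa] [b gb]; exists (fun k => a k - b k); exact: A_coefsB.
Qed.

(** * Completeness and point evaluations *)

(** Each coefficient of a Cauchy sequence is Cauchy, as a single term bounds the
    weighted norm from below; let alpha collect the limits. A bound on the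
    partial sums of |a_m - a_n|^2 that is uniform in n survives n -> oo, since
    these are finite sums, and gives both that alpha is in the weighted space
    and that the distance to it tends to 0. *)
Lemma A_complete : ip_complete (@A_space R) (@A_ip R).
Proof.
move=> u Au cu.
have [a ua] : {a : nat -> nat -> H | forall n, A_coefs (u n) (a n)}.
  exists (fun n => A_coef (u n)) => n; have [b ub] := Au n.
  by rewrite (A_coefE ub).
have dge0 m n : 0 <= ip_dist (@A_ip R) (u m) (u n) by exact: sqrtr_ge0.
have partial m n K :
    series (fun k => A_weight R k * `|a m k - a n k| ^+ 2) K <=
    ip_dist (@A_ip R) (u m) (u n) ^+ 2.
  exact: (A_ip_norm_coef (A_coefsB (ua m) (ua n))).
have acvg k : cvgn (a ^~ k).
  apply: cauchy_cvg; apply: cauchy_exP => e e0.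
  have w0 := A_weight_gt0 k.
  have [|N cN] := cu (Num.sqrt (A_weight R k) * e).
    by rewrite mulr_gt0// sqrtr_gt0.
  exists (a N k); exists N => // n /= Nn; rewrite -ball_normE /=.
  rewrite -(@ltr_pM2l _ (Num.sqrt (A_weight R k))) ?sqrtr_gt0//.
  apply: le_lt_trans (cN N n (leqnn _) Nn).
  rewrite -(@ler_pXn2r _ 2%N)// ?nnegrE ?mulr_ge0 ?sqrtr_ge0//.
  rewrite exprMn sqr_sqrtr ?(ltW w0)//.
  exact: (A_ip_norm_term (A_coefsB (ua N) (ua n))).
pose alpha k := limn (a ^~ k).
have close e : 0 < e -> exists N, forall m, (N <= m)%N -> forall K,
    series (fun k => A_weight R k * `|a m k - alpha k| ^+ 2) K <= e ^+ 2.
  move=> /cu[N cN]; exists N => m Nm K.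
  have lK :
      series (fun k => A_weight R k * `|a m k - a n k| ^+ 2) K @[n --> \oo] -->
      series (fun k => A_weight R k * `|a m k - alpha k| ^+ 2) K.
    apply: cvg_big => [|k _]; first exact: add_continuous.
    apply: cvgMl_tmp; rewrite expr2; under eq_fun do rewrite expr2.
    have lk : `|a m k - a n k| @[n --> \oo] --> `|a m k - alpha k|.
      by apply: cvg_norm; apply: cvgB; [exact: cvg_cst|exact: acvg].
    exact: cvgM.
  apply: (cvgn_le_bound lK).
  exists N => // n /= Nn; apply: (le_trans (partial m n K)).
  by rewrite lerXn2r ?nnegrE// ltW// ?cN// (le_lt_trans (dge0 m n))// cN.
have ell2_diff m : ell2 (fun k => a m k - alpha k) -> ell2 alpha.
  move=> dm; rewrite (_ : alpha = fun k => a m k + (a m k - alpha k) * -1).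
    by apply: ell2D; [exact: (ua m).1|exact: ell2Z].
  by apply/funext => k; rewrite mulrN1 opprB addrC subrK.
have ell2_close e n : (forall K, series
    (fun k => A_weight R k * `|a n k - alpha k| ^+ 2) K <= e ^+ 2) ->
    ell2 (fun k => a n k - alpha k).
  by apply: bounded_series => k; exact: ell2_term_ge0.
have sa : ell2 alpha.
  have [N cN] := close 1 ltr01.
  by apply: (ell2_diff N); apply: (ell2_close 1); exact: cN.
have fa := A_fun_coefs sa.
exists (A_fun alpha); first by exists alpha.
apply/cvgr0Pnorm_lt => e e0; have [|N cN] := close (e / 2).
  by rewrite divr_gt0.
exists N => // m /= Nm.
have Bm := A_coefsB (ua m) fa.
rewrite ger0_norm ?sqrtr_ge0//.
apply: (@le_lt_trans _ _ (e / 2)); last by lra.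
rewrite -(@ler_pXn2r _ 2%N)// ?nnegrE ?sqrtr_ge0 ?divr_ge0 ?(ltW e0)//.
rewrite A_ip_norm_sqr; last by eexists; exact: Bm.
by apply: (cvgn_le_bound (A_ip_self Bm)); apply: nearW => n; exact: cN.
Qed.

(** Summing the bound of [Qpoly_young] gives |f(q)| <= s ||f||^2 + C / s, with C
    the squared norm of the kernel at [q]; the value s = 1 / ||f|| makes it
    linear in ||f||. *)
Lemma A_eval_bounded q : exists2 C : R, 0 <= C &
  forall f, A_space f -> `|f q| <= (C + 1) * ip_norm (@A_ip R) f.
Proof.
pose C := limn (series (fun k => A_weight R k * `|kernel_coef q k| ^+ 2)).
have C0 : 0 <= C.
  apply: limr_ge; first exact: ell2_kernel_coef.
  apply: nearW => n; rewrite /series /= sumr_ge0// => k _.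
  exact: ell2_term_ge0.
exists C => // f Af; have : 0 <= ip_norm (@A_ip R) f by exact: sqrtr_ge0.
rewrite le_eqVlt => /orP[/eqP/esym f0|f0].
  by rewrite f0 mulr0 (A_ip_norm_eq0 Af f0) normr0.
have [alpha fa] := Af.
set s := ip_norm _ f in f0 *.
have si : 0 < s^-1 by rewrite invr_gt0.
have sC : series (fun k => s^-1 * (A_weight R k * `|alpha k| ^+ 2) +
    s^-1^-1 * (A_weight R k * `|kernel_coef q k| ^+ 2)) @ \oo -->
    s^-1 * s ^+ 2 + s * C.
  rewrite -[X in X * C]invrK (A_ip_norm_sqr Af : s ^+ 2 = _).
  exact: (@cvg_series_comb R _ _ s^-1 s^-1^-1 _ _ (A_ip_self fa)
    (@ell2_kernel_coef q)).
have := norm_series_le (fun k => Qpoly_young alpha q k si) (fa.2 q) sC.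
by rewrite expr2 mulKf ?gt_eqF// mulrDl mul1r addrC [C * s]mulrC.
Qed.

Lemma A_evaluation_continuous q :
  evaluation_continuous (@A_space R) (@A_ip R) q.
Proof.
have [C C0 evC] := A_eval_bounded q; have C1 : 0 < C + 1 by rewrite ltr_wpDl.
move=> f Af e e0; exists (e / (C + 1)); first by rewrite divr_gt0.
move=> g Ag gf; apply: le_lt_trans (evC _ (A_spaceB Ag Af)) _.
by rewrite mulrC -ltr_pdivlMr.
Qed.

Lemma A_right_rkhs : right_rkhs (@A_space R) (@A_ip R).
Proof.
split.
- exact: A_right_subspace.
- exact: A_right_inner_product.
- exact: A_complete.
- exact: A_evaluation_continuous.
Qed.

(** * The reproducing kernel *)

(** The scalar factors of T_k(p) and T_k(q) multiply to the inverse of the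
    weight. *)
Lemma A_kernel_termE (p q : H) :
  A_kernel_term p q = fun k => Qpoly k p * kernel_coef q k.
Proof.
apply/funext => k; rewrite /A_kernel_term /Tpoly quat_conjZ.
rewrite -scalerAl -scalerAr scalerA -expr2 sqr_sqrtr ?divr_ge0//.
by rewrite -scalerAr /A_weight invf_div.
Qed.

Lemma A_kernel_coefs (q : H) : A_coefs (@A_kernel R ^~ q) (kernel_coef q).
Proof.
rewrite (_ : @A_kernel R ^~ q = A_fun (kernel_coef q)).
  exact/A_fun_coefs/ell2_kernel_coef.
by apply/funext => p; rewrite /A_kernel A_kernel_termE.
Qed.

Lemma A_kernel_reproducing (f : H -> H) q :
  A_space f -> f q = A_ip f (@A_kernel R ^~ q).
Proof.
move=> [alpha fa]; apply: cvg_unique (fa.2 q) _ => //.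
rewrite (_ : (fun k => _) = A_ip_term alpha (kernel_coef q)).
  exact: A_ip_cvg fa (A_kernel_coefs q).
apply/funext => k; rewrite /A_ip_term /kernel_coef quat_conjZ quat_conjK.
by rewrite -scalerAl scalerA divff ?scale1r// gt_eqF// A_weight_gt0.
Qed.

End WeightedSequences.

(* The first two conjuncts say that the inner product does not depend on the
   choice of coefficients and that the series involved converge. *)
Theorem theorem4p13 (R : realType) :
  [/\ forall (f g : quat R -> quat R) (alpha beta : nat -> quat R),
        A_coefs f alpha -> A_coefs g beta ->
        series (A_ip_term alpha beta) @ \oo --> A_ip f g,
      forall p q : quat R,
        series (A_kernel_term p q) @ \oo --> A_kernel p q,
      right_rkhs (@A_space R) (@A_ip R),
      reproducing_kernel (@A_space R) (@A_ip R) (@A_kernel R) &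
      forall (q : quat R) (f : quat R -> quat R), A_space f ->
        f q = A_ip f (fun p => A_kernel p q)].
Proof.
split.
- by move=> f g alpha beta; exact: A_ip_cvg.
- by move=> p q; rewrite A_kernel_termE; exact: (A_kernel_coefs q).2.
- exact: A_right_rkhs.
- move=> q; split; first by exists (kernel_coef q); exact: A_kernel_coefs.
  by move=> f; exact: A_kernel_reproducing.
- by move=> q f; exact: A_kernel_reproducing.
Qed.
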